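(* Let $\mathcal{A}$ be an additive category, let $(X_n)_{n\in\mathbb{N}}$ and $(Y_i)_{i\in I}$ be families of objects in $\mathcal{A}$ such that the product $\prod_{n\in\mathbb{N}}X_n$ and the coproduct $\coprod_{i\in I}Y_i$ exist in $\mathcal{A}$, and let \[\phi\colon \prod_{n\in\mathbb{N}}X_n\longrightarrow \coprod_{i\in I}Y_i\] be a morphism. Let $\gamma=(C_n\to C_{n+1})_{n\in\mathbb{N}}$ be a sequence of morphisms in $\mathcal{A}$ such that the object $C=C_0$ is finitely generated, and for $n\in\mathbb{N}$ let $\gamma_n\colon C_0\to C_n$ denote the composite of the first $n$ morphisms of the sequence. Then there exists $m\in\mathbb{N}$ such that for almost all $j\in I$ the following holds: for every morphism $\theta\colon C_m\to\prod_{n\in\mathbb{N}}X_n$ whose components $\theta_n\colon C_m\to X_n$ satisfy $\theta_n=0$ for all $n<m$, the composite \[C\xrightarrow{\ \gamma_m\ }C_m\xrightarrow{\ \theta\ }\prod_{n\in\mathbb{N}}X_n\xrightarrow{\ \phi\ }\coprod_{i\in I}Y_i\longrightarrow Y_j\] (where the last morphism is the canonical projection) factors through $\gamma_n\colon C\to C_n$ for all $n\in\mathbb{N}$.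
   Context: Here $\mathbb{N}=\{0,1,2,\ldots\}$, and $\gamma_0$ is the identity of $C_0$. An object $C$ of an additive category is called finitely generated if any morphism $C\to\coprod_{i\in I}X_i$ (into any coproduct existing in the category) factors through the canonical morphism $\coprod_{i\in J}X_i\to\coprod_{i\in I}X_i$ for some finite subset $J\subseteq I$. The canonical projection $\coprod_{i\in I}Y_i\to Y_j$ is the morphism that is the identity on the summand $Y_j$ and zero on $Y_i$ for $i\neq j$. ''For almost all $j\in I$'' means for all $j\in I$ outside some finite subset of $I$; this finite subset does not depend on $\theta$ or $n$. A morphism $f\colon C\to Y$ factors through $\gamma_n\colon C\to C_n$ if $f=g\circ\gamma_n$ for some morphism $g\colon C_n\to Y$. *)

(* Defs.v *)
From mathcomp Require Import all_boot ssralg.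
From mathcomp Require Import boolp classical_sets cardinality.

Set Implicit Arguments.
Unset Strict Implicit.
Unset Printing Implicit Defensive.

Declare Scope cat_scope.
Delimit Scope cat_scope with cat.
Local Open Scope cat_scope.
Local Open Scope ring_scope.

Reserved Notation "g ∘ f" (at level 40, left associativity).

                                            
Record preadditive_category := PreadditiveCategory {
  object :> Type;
  Hom : object -> object -> zmodType;
  idm : forall a, Hom a a;
  mcomp : forall a b c, Hom b c -> Hom a b -> Hom a c
    where "g ∘ f" := (mcomp g f);
  mcompA : forall a b c d (h : Hom c d) (g : Hom b c) (f : Hom a b),
    h ∘ (g ∘ f) = h ∘ g ∘ f;
  mcomp1m : forall a b (f : Hom a b), idm b ∘ f = f;
  mcompm1 : forall a b (f : Hom a b), f ∘ idm a = f;
  mcompDl : forall a b c (g h : Hom b c) (f : Hom a b),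
    (g + h) ∘ f = g ∘ f + h ∘ f;
  mcompDr : forall a b c (g : Hom b c) (f h : Hom a b),
    g ∘ (f + h) = g ∘ f + g ∘ h
}.

Arguments Hom {p} a b.
Arguments idm {p} a.
Arguments mcomp {p a b c} g f.

Notation "g ∘ f" := (mcomp g f) : cat_scope.

Record product (A : preadditive_category) (I : Type) (X : I -> A) := Product {
  prod_obj :> A;
  prod_proj : forall i, Hom prod_obj (X i);
  tuple_mor : forall Z : A, (forall i, Hom Z (X i)) -> Hom Z prod_obj;
  proj_tuple : forall (Z : A) (f : forall i, Hom Z (X i)) i,
    prod_proj i ∘ tuple_mor f = f i;
  tuple_unique : forall (Z : A) (f : forall i, Hom Z (X i)) (h : Hom Z prod_obj),
    (forall i, prod_proj i ∘ h = f i) -> h = tuple_mor f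
}.

Record coproduct (A : preadditive_category) (I : Type) (X : I -> A) :=
  Coproduct {
  coprod_obj :> A;
  coprod_inj : forall i, Hom (X i) coprod_obj;
  cotuple_mor : forall Z : A, (forall i, Hom (X i) Z) -> Hom coprod_obj Z;
  cotuple_inj : forall (Z : A) (f : forall i, Hom (X i) Z) i,
    cotuple_mor f ∘ coprod_inj i = f i;
  cotuple_unique : forall (Z : A) (f : forall i, Hom (X i) Z)
      (h : Hom coprod_obj Z),
    (forall i, h ∘ coprod_inj i = f i) -> h = cotuple_mor f
}.

Arguments prod_proj {A I X} p i.
Arguments tuple_mor {A I X} p {Z} f.
Arguments coprod_inj {A I X} c i.
Arguments cotuple_mor {A I X} c {Z} f.

                                                                            
                                                                        
Record additive_category := AdditiveCategory {
  preadditive :> preadditive_category;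
  finite_products : forall (n : nat) (X : 'I_n -> preadditive),
    inhabited (product X)
}.

                                                                             
                                          
Definition delta_mor (A : preadditive_category) (I : Type) (X : I -> A)
    (i j : I) : Hom (X i) (X j) :=
  match pselect (i = j) with
  | left e => eq_rect i (fun k => Hom (X i) (X k)) (idm (X i)) j e
  | right _ => 0
  end.

Definition coprod_proj (A : preadditive_category) (I : Type) (X : I -> A)
    (S : coproduct X) (j : I) : Hom S (X j) :=
  cotuple_mor S (fun i => delta_mor X i j).

Lemma coprod_proj_inj (A : preadditive_category) (I : Type) (X : I -> A)
    (S : coproduct X) (j : I) : coprod_proj S j ∘ coprod_inj S j = idm (X j).
Proof.
rewrite cotuple_inj /delta_mor; case: pselect => // e.
by rewrite (Prop_irrelevance e erefl).
Qed.

Lemma coprod_proj_inj_neq (A : preadditive_category) (I : Type) (X : I -> A)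
    (S : coproduct X) (i j : I) : i <> j -> coprod_proj S j ∘ coprod_inj S i = 0.
Proof. by move=> ij; rewrite cotuple_inj /delta_mor; case: pselect. Qed.

                          
Definition factors_through (A : preadditive_category) (a b c : A)
    (f : Hom a c) (g : Hom a b) : Prop :=
  exists h : Hom b c, f = h ∘ g.

Definition subcoprod_mor (A : preadditive_category) (I : Type) (X : I -> A)
    (S : coproduct X) (J : set I) (SJ : coproduct (fun i : J => X (val i))) :
    Hom SJ S :=
  cotuple_mor SJ (fun i : J => coprod_inj S (val i)).

                                                                            
                                                                         
                                 
Definition finitely_generated (A : additive_category) (C : A) : Prop :=
  forall (I : Type) (X : I -> A) (S : coproduct X) (f : Hom C S),
  exists2 J : set I, finite_set J &
  exists (SJ : coproduct (fun i : J => X (val i))) (g : Hom C SJ),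
    f = subcoprod_mor S SJ ∘ g.

Fixpoint seq_comp (A : preadditive_category) (C : nat -> A)
    (c : forall n, Hom (C n) (C n.+1)) (n : nat) : Hom (C 0%N) (C n) :=
  match n with
  | 0 => idm (C 0%N)
  | k.+1 => c k ∘ seq_comp c k
  end.

(* Main.v *)
Require Import Defs.
From mathcomp Require Import all_boot ssralg.
From mathcomp Require Import boolp classical_sets cardinality.

Import GRing.Theory.
Local Open Scope ring_scope.
Local Open Scope cat_scope.

(** Diagonal argument.  If the claim fails, one builds recursively indices
    [m_0 < m_1 < ...], elements [j_k] and morphisms [u_k : C -> prod X] that
    factor through [gamma_(m_k)] and have vanishing components below [m_k], such
    that [p_(j_k) phi u_k] does not factor through [gamma_(m_(k+1))] while
    [p_(j_k) phi u_l = 0] for [l < k].  The infinite sum [v] of the [u_k] makes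
    sense componentwise, and [v - (u_0 + ... + u_k)] factors through
    [gamma_(m_(k+1))]; hence [p_(j_k) phi v != 0] for all [k].  As the [j_k] are
    distinct, this contradicts the finite generation of [C]. *)

Section Preadditive.
Variable A : preadditive_category.

Lemma mcomp0m (a b c : A) (f : Hom a b) : (0 : Hom b c) ∘ f = 0.
Proof. by apply: (addIr (0 ∘ f)); rewrite -mcompDl !add0r. Qed.

Lemma mcompm0 (a b c : A) (g : Hom b c) : g ∘ (0 : Hom a b) = 0.
Proof. by apply: (addIr (g ∘ 0)); rewrite -mcompDr !add0r. Qed.

Lemma mcompmN (a b c : A) (g : Hom b c) (f : Hom a b) : g ∘ (- f) = - (g ∘ f).
Proof. by apply: (addIr (g ∘ f)); rewrite -mcompDr !addNr mcompm0. Qed.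

Lemma mcompNm (a b c : A) (g : Hom b c) (f : Hom a b) : (- g) ∘ f = - (g ∘ f).
Proof. by apply: (addIr (g ∘ f)); rewrite -mcompDl !addNr mcomp0m. Qed.

Lemma mcompm_sum (a b c : A) (g : Hom b c) m n (f : nat -> Hom a b) :
  g ∘ (\sum_(m <= i < n) f i) = \sum_(m <= i < n) g ∘ f i.
Proof. exact: (big_morph _ (mcompDr g) (mcompm0 _ _ _ g)). Qed.

Lemma prod_ext (I : Type) (X : I -> A) (P : product X) (Z : A)
    (f g : Hom Z P) :
  (forall i, prod_proj P i ∘ f = prod_proj P i ∘ g) -> f = g.
Proof. by move=> fg; rewrite (tuple_unique fg) -(tuple_unique (fun=> erefl)). Qed.

Lemma coprod_ext (I : Type) (X : I -> A) (S : coproduct X) (Z : A)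
    (f g : Hom S Z) :
  (forall i, f ∘ coprod_inj S i = g ∘ coprod_inj S i) -> f = g.
Proof. by move=> fg; rewrite (cotuple_unique fg) -(cotuple_unique (fun=> erefl)). Qed.

Lemma factors_through0 (a b c : A) (g : Hom a b) :
  factors_through (0 : Hom a c) g.
Proof. by exists 0; rewrite mcomp0m. Qed.

Lemma factors_throughD (a b c : A) (f f' : Hom a c) (g : Hom a b) :
  factors_through f g -> factors_through f' g -> factors_through (f + f') g.
Proof. by move=> [h ->] [h' ->]; exists (h + h'); rewrite mcompDl. Qed.

Lemma factors_through_comp (a b c d : A) (k : Hom c d) (f : Hom a c)
    (g : Hom a b) : factors_through f g -> factors_through (k ∘ f) g.
Proof. by move=> [h ->]; exists (k ∘ h); rewrite mcompA. Qed.

Lemma factors_through_trans (a b c d : A) (f : Hom a d) (g : Hom a c)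
    (h : Hom a b) :
  factors_through f g -> factors_through g h -> factors_through f h.
Proof. by move=> [k ->]; apply: factors_through_comp. Qed.

(** Factorizations chosen separately for each component assemble into a single one by the universal
    property of [P]. *)
Lemma factors_through_prod (I : Type) (X : I -> A) (P : product X) (a b : A)
    (f : Hom a P) (g : Hom a b) :
  (forall i, factors_through (prod_proj P i ∘ f) g) -> factors_through f g.
Proof.
move=> fg.
pose h i := projT1 (cid (fg i)).
exists (tuple_mor P h); apply: prod_ext => i.
by rewrite mcompA proj_tuple /h; case: cid.
Qed.

Lemma seq_comp_factors (C : nat -> A) (c : forall n, Hom (C n) (C n.+1)) m n :
  (m <= n)%N -> factors_through (seq_comp c n) (seq_comp c m).
Proof.
elim: n => [|n IHn]; rewrite leq_eqVlt => /predU1P[->|] //.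
- by exists (idm _); rewrite mcomp1m.
- by exists (idm _); rewrite mcomp1m.
- by rewrite ltnS => /IHn; apply: factors_through_comp.
Qed.

End Preadditive.

(** Finite generation in terms of supports: a projection to an index outside [J] kills every
    injection from the subcoproduct over [J]. *)
Lemma finitely_generated_support (A : additive_category) (C : A) (I : Type)
    (Y : I -> A) (S : coproduct Y) (f : Hom C S) :
  finitely_generated C ->
  exists2 J : set I, finite_set J &
    forall j, ~ J j -> coprod_proj S j ∘ f = 0.
Proof.
move=> /(_ I Y S f)[J finJ [SJ [g ->]]]; exists J => // j nJj.
rewrite mcompA; suff -> : coprod_proj S j ∘ subcoprod_mor S SJ = 0.
  exact: mcomp0m.
apply: coprod_ext => i.
rewrite -mcompA cotuple_inj mcomp0m coprod_proj_inj_neq // => ij.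
by apply: nJj; rewrite -ij; exact: set_valP.
Qed.

Theorem lemma4 (A : additive_category)
    (X : nat -> A) (P : product X)
    (I : Type) (Y : I -> A) (S : coproduct Y)
    (phi : Hom P S)
    (C : nat -> A) (c : forall n : nat, Hom (C n) (C n.+1))
    (fgC : finitely_generated (C 0%N)) :
  exists (m : nat) (F : set I), finite_set F /\
    forall j : I, ~ F j ->
    forall theta : Hom (C m) P,
      (forall n : nat, (n < m)%N -> prod_proj P n ∘ theta = 0) ->
      forall n : nat,
        factors_through
          (coprod_proj S j ∘ phi ∘ theta ∘ seq_comp c m)
          (seq_comp c n).
Proof.
apply: contrapT => nex.
pose gam := seq_comp c.
(* A state pairs the current bound with a finite set holding the indices chosen so far and the
   supports of the composites [phi ∘ u]. Choosing the next [j] outside this set makes it new and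
   makes its projection kill all earlier [phi ∘ u]. *)
pose state := (nat * {F : set I | finite_set F})%type.
pose step (s : state) (y : state * (I * Hom (C 0%N) P)) :=
  let: (t, (j, u)) := y in
  [/\ (s.1 < t.1)%N,
      [/\ (sval s.2 `<=` sval t.2)%classic, sval t.2 j & ~ sval s.2 j],
      forall i, ~ sval t.2 i -> coprod_proj S i ∘ phi ∘ u = 0,
      factors_through u (gam s.1) /\
      (forall n, (n < s.1)%N -> prod_proj P n ∘ u = 0) &
      ~ factors_through (coprod_proj S j ∘ phi ∘ u) (gam t.1)].
have stepP s : exists y, step s y.
  case: s => m [F finF].
  apply: contrapT => none; apply: nex; exists m, F; split=> // j nFj theta th0 n.
  apply: contrapT => nfact; apply: none.
  set u := theta ∘ gam m.
  have [J finJ J0] := finitely_generated_support _ _ _ _ S (phi ∘ u) fgC.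
  have finFJ : finite_set (F `|` (j |` J))%classic.
    by rewrite !finite_setU; split=> //; split.
  (* In the new bound, [m.+1] forces strict growth, while [n] carries over the failure to factor,
     since [gam (maxn m.+1 n)] itself factors through [gam n]. *)
  exists ((maxn m.+1 n, exist _ _ finFJ), (j, u)); split=> /=.
  - exact: leq_maxl.
  - split=> [i Fi| |//]; first by left.
    by right; left.
  - by move=> i nFi; rewrite -mcompA J0 // => Ji; apply: nFi; right; right.
  - split; first by exists theta.
    by move=> i im; rewrite mcompA th0 ?mcomp0m.
  - move=> fact; apply: nfact; rewrite -[X in factors_through X]mcompA.
    apply: factors_through_trans fact _.
    by apply: seq_comp_factors; exact: leq_maxr.
have {stepP}[next nextP] := choice stepP.
pose st k := iter k (fun s => (next s).1) (0%N, exist _ _ (finite_set0 I)).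
pose m k := (st k).1; pose F k := sval (st k).2.
pose j k := (next (st k)).2.1; pose u k := (next (st k)).2.2.
have stP k : step (st k) (st k.+1, (j k, u k)).
  have := nextP (st k).
  by rewrite [st k.+1]/(next (st k)).1 /j /u; case: (next _) => [? []].
have m_mono : {homo m : k l / (k <= l)%N}.
  apply: homo_leq => [//|? ? ?|k]; first exact: leq_trans.
  by have [/ltnW] := stP k.
have leq_m k : (k <= m k)%N.
  by elim: k => // k IHk; have [mk _ _ _ _] := stP k; apply: leq_ltn_trans mk.
have F_mono k l : (k <= l)%N -> (F k `<=` F l)%classic.
  apply: (@homo_leq _ F (fun D E => (D `<=` E)%classic)).
  - exact: subset_refl.
  - by move=> ? ? ?; apply: subset_trans.
  - by move=> {}k; have [_ []] := stP k.
have j_inj : injective j.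
  suff j_neq k l : (k < l)%N -> j k <> j l.
    by move=> k l jkl; case: (ltngtP k l) => // /j_neq; rewrite jkl.
  move=> kl jkl; have [_ [_ Fj _] _ _ _] := stP k.
  have [_ [_ _ nFj] _ _ _] := stP l.
  by apply: nFj; rewrite -/(j l) -jkl; apply: F_mono kl _ Fj.
have u0 l n : (n < l)%N -> prod_proj P n ∘ u l = 0.
  move=> nl; have [_ _ _ [_ ->//]] := stP l.
  exact: leq_trans nl (leq_m l).
(* Truncating at [l = n] loses nothing: for [l > n] the [n]-th component of [u l] vanishes, because
   [l <= m l]. *)
pose v := tuple_mor P (fun n => \sum_(0 <= l < n.+1) prod_proj P n ∘ u l).
have tail k : factors_through (v - \sum_(0 <= l < k.+1) u l) (gam (m k.+1)).
  apply: factors_through_prod => n.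
  (* Padding with zero terms gives a range that can also be split at [k.+1], whichever of [n] and
     [k] is larger. *)
  have vn : prod_proj P n ∘ v = \sum_(0 <= l < n.+1 + k.+1) prod_proj P n ∘ u l.
    rewrite proj_tuple [RHS](@big_cat_nat _ _ _ n.+1) ?leq_addr //=.
    rewrite [X in _ = _ + X]big_nat [X in _ = _ + X]big1 ?addr0 // => l /andP[nl _].
    exact: u0.
  rewrite mcompDr mcompmN mcompm_sum vn.
  rewrite (@big_cat_nat _ _ _ k.+1) ?leq_addl //= addrAC subrr add0r.
  rewrite big_nat; elim/big_ind: _ => [|? ?|l /andP[kl _]].
  - exact: factors_through0.
  - exact: factors_throughD.
  - apply: factors_through_comp; have [_ _ _ [ul _] _] := stP l.
    by apply: factors_through_trans ul _; apply: seq_comp_factors; apply: m_mono.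
have v_neq0 k : coprod_proj S (j k) ∘ phi ∘ v <> 0.
  move=> v0; have [_ [_ _ nFj] _ _] := stP k; apply; rewrite /= -/(j k) -/(u k).
  set p := coprod_proj S (j k) ∘ phi.
  (* Here [p ∘ v = 0] by assumption and [p ∘ u l = 0] for [l < k], so by [tail] the forbidden
     factorization of [p ∘ u k] would exist. *)
  have -> : p ∘ u k = - (p ∘ (v - \sum_(0 <= l < k.+1) u l)).
    rewrite mcompDr v0 add0r mcompmN opprK mcompm_sum big_nat_recr //=.
    rewrite big_nat big1 ?add0r // => l /andP[_ lk].
    have [_ _ supp _ _] := stP l; apply: supp => /= Fj.
    by apply: nFj; apply: F_mono lk _ Fj.
  by rewrite -mcompmN; apply: factors_through_comp; have [h ->] := tail k;
    exists (- h); rewrite mcompNm.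
have [J finJ J0] := finitely_generated_support _ _ _ _ S (phi ∘ v) fgC.
(* Every [j k] lies in the finite support [J] of [phi ∘ v], so injectivity of [j] would make the
   natural numbers finite. *)
apply: infinite_nat; suff <- : (j @^-1` J)%classic = [set: nat]%classic.
  by apply: finite_preimage finJ => ? ? _ _; apply: j_inj.
apply/seteqP; split=> // k _; apply: contrapT => /J0.
by rewrite mcompA; apply: v_neq0.
Qed.
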